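(* Let $a>0$ and $\Omega=(-a,a)$. Suppose the analytic eigencurve $\lambda=\lambda(\alpha)$ of the Robin Laplacian on $\Omega$ remains bounded as $\alpha\to\infty$ in $\mathbb{C}$. Then it converges to some eigenvalue of the Dirichlet Laplacian on $\Omega$, that is, there exists some $j\in\mathbb{Z}$ such that $$\lambda(\alpha)\to\frac{\pi^2j^2}{4a^2}$$ as $\alpha\to\infty$.
   Context: For $\alpha\in\mathbb{C}$, the eigenvalue problem of the Robin Laplacian on $(-a,a)$ is $-u''=\lambda u$ on $(-a,a)$, $-u'(-a)+\alpha u(-a)=0$, $u'(a)+\alpha u(a)=0$. An analytic eigencurve is a function $\alpha\mapsto\lambda(\alpha)$, analytic in $\alpha$ (away from crossings of eigenvalues), such that $\lambda(\alpha)$ is an eigenvalue of this problem for each $\alpha$. The Dirichlet Laplacian on $(-a,a)$ is the operator $u\mapsto-u''$ with boundary conditions $u(-a)=u(a)=0$. *)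

(* Defs.v *)
From Stdlib Require Import Reals.
From Coquelicot Require Import Coquelicot.

Open Scope R_scope.

Definition segment (x y : R) : R -> Prop := fun t => x <= t <= y.

(* Two-sided derivative in the interior of [D], one-sided at its endpoints. *)
Definition is_derive_within (D : R -> Prop) (f : R -> C) (x : R) (l : C) : Prop :=
  @filterdiff R_AbsRing R_NormedModule C_R_NormedModule f
    (within D (locally x)) (fun h : R => scal h l).

(* [u] is of class C^2 on [-a, a], with first and second derivatives [u1], [u2]. *)
Definition class_C2 (a : R) (u u1 u2 : R -> C) : Prop :=
  (forall x, segment (- a) a x -> is_derive_within (segment (- a) a) u x (u1 x)) /\
  (forall x, segment (- a) a x -> is_derive_within (segment (- a) a) u1 x (u2 x)) /\
  continuous_on (segment (- a) a) u2.

Definition robin_eigenvalue (a : R) (alpha lam : C) : Prop :=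
  exists u u1 u2 : R -> C,
    class_C2 a u u1 u2 /\
    (exists x, segment (- a) a x /\ u x <> 0%C) /\
    (forall x, - a < x < a -> (- u2 x)%C = (lam * u x)%C) /\
    (- u1 (- a)%R + alpha * u (- a)%R)%C = 0%C /\
    (u1 a + alpha * u a)%C = 0%C.

Definition dirichlet_eigenvalue (a : R) (lam : C) : Prop :=
  exists u u1 u2 : R -> C,
    class_C2 a u u1 u2 /\
    (exists x, segment (- a) a x /\ u x <> 0%C) /\
    (forall x, - a < x < a -> (- u2 x)%C = (lam * u x)%C) /\
    u (- a)%R = 0%C /\
    u a = 0%C.

(* Distinct eigenvalues run into each other at the value [mu] as the
   parameter tends to [alpha]. *)
Definition eigenvalue_crossing (a : R) (alpha mu : C) : Prop :=
  forall eps : R, 0 < eps ->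
    exists beta mu1 mu2 : C,
      Cmod (beta - alpha) < eps /\
      Cmod (mu1 - mu) < eps /\ Cmod (mu2 - mu) < eps /\
      mu1 <> mu2 /\
      robin_eigenvalue a beta mu1 /\ robin_eigenvalue a beta mu2.

Definition analytic_at (f : C -> C) (z : C) : Prop :=
  locally z (fun w : C => @ex_derive C_AbsRing C_NormedModule f w).

(* The eigenvalues are branches of a multivalued function of alpha, with
   branch points at crossings, so a single-valued branch [lam] lives on an open
   set [D] of parameters; values of [lam] outside [D] are irrelevant.  Nothing
   is required of [lam] at a crossing beyond being an eigenvalue there. *)
Definition analytic_eigencurve (a : R) (D : C -> Prop) (lam : C -> C) : Prop :=
  open D /\
  (forall alpha, D alpha -> robin_eigenvalue a alpha (lam alpha)) /\
  (forall alpha, D alpha -> ~ eigenvalue_crossing a alpha (lam alpha) ->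
     analytic_at lam alpha).

(* The filter "|alpha| -> oo, alpha in D". *)
Definition at_infinity (D : C -> Prop) : (C -> Prop) -> Prop :=
  within D (fun P => exists R0 : R, forall alpha : C, R0 < Cmod alpha -> P alpha).

Definition joined_in (E : C -> Prop) (z w : C) : Prop :=
  exists gamma : R -> C,
    continuous_on (segment 0 1) gamma /\
    gamma 0 = z /\ gamma 1 = w /\
    (forall t, segment 0 1 t -> E (gamma t)).

(* [D] reaches infinity, and does so in one piece: otherwise [lam] could follow
   unrelated branches in different unbounded parts of [D].  Examples are the
   whole plane, the exterior of a disc, a sector, a neighbourhood of a simple
   curve going to infinity. *)
Definition connected_at_infinity (D : C -> Prop) : Prop :=
  (forall R0 : R, exists alpha, D alpha /\ R0 < Cmod alpha) /\
  (forall R0 : R, exists R1 : R, forall alpha beta,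
     D alpha -> R1 < Cmod alpha -> D beta -> R1 < Cmod beta ->
     joined_in (fun z => D z /\ R0 < Cmod z) alpha beta).

Definition bounded_at_infinity (D : C -> Prop) (lam : C -> C) : Prop :=
  exists M : R, at_infinity D (fun alpha => Cmod (lam alpha) <= M).

(* Main.v *)
(* Write [lam = - theta ^ 2].  On a solution of [u'' = theta ^ 2 u] the quantities
   [(u' - theta u) e^(theta x)] and [(u' + theta u) e^(- theta x)] are constant, and
   comparing them at the two endpoints turns the Robin conditions into
   [(alpha + theta) e^(2 a theta) = s (alpha - theta)] with [s = 1] or [s = -1].

   For [lam] bounded and [alpha] large this forces [e^(4 a theta)] to be close to 1,
   so [theta] is close to some [i pi k / (2 a)] and [lam] to [pi^2 k^2 / (4 a^2)].
   Eliminating the exponential between two solutions at distance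
   [d = theta1 - theta2] shows that, for [alpha] large, they coincide as soon as
   [4 a |d| <= 1].  Hence no eigenvalues cross there, so [lam] is continuous; and
   since [theta = 0] solves the characteristic equation without being an
   eigenvalue, [k = 0] is excluded.  Finally, along a path near infinity [Re lam]
   is continuous and stays close to integer multiples of [pi^2 / (4 a^2)], so by
   the intermediate value theorem [k ^ 2] is constant. *)

Require Import Defs.
From Stdlib Require Import Reals ZArith Lra Lia.
From Coquelicot Require Import Coquelicot.

(** * The complex exponential *)

Lemma Ceq_parts (z w : C) : Re z = Re w -> Im z = Im w -> z = w.
Proof. destruct z, w; simpl; congruence. Qed.

Lemma Cmult_eq_0 (z w : C) : (z * w = 0)%C -> z = 0%C \/ w = 0%C.
Proof.
intros H.
assert (E : Cmod z * Cmod w = 0) by (rewrite <- Cmod_mult, H; apply Cmod_0).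
destruct (Rmult_integral _ _ E) as [E0|E0]; [left|right]; now apply Cmod_eq_0.
Qed.

(** Half-angle formulas: the parts of the root are [sqrt ((m + Re z) / 2)] and
    [sqrt ((m - Re z) / 2)], whose product is [|Im z| / 2]; the sign of [Im z] decides their
    relative sign. *)
Lemma Csqrt_exists (z : C) : exists w : C, (w * w)%C = z.
Proof.
set (m := Cmod z).
pose proof (re_le_Cmod z) as Hre. apply Rabs_le_between in Hre. fold m in Hre.
assert (Hm : m * m = Re z * Re z + Im z * Im z).
{ pose proof (Cmod2_alt z). fold m in H. nra. }
assert (Hp := sqrt_sqrt ((m + Re z) / 2) ltac:(lra)).
assert (Hq := sqrt_sqrt ((m - Re z) / 2) ltac:(lra)).
assert (Hpq : sqrt ((m + Re z) / 2) * sqrt ((m - Re z) / 2) = Rabs (Im z) / 2).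
{ rewrite <- sqrt_mult by lra.
  replace ((m + Re z) / 2 * ((m - Re z) / 2)) with (Rsqr (Im z / 2)) by (unfold Rsqr; nra).
  rewrite sqrt_Rsqr_abs. unfold Rdiv. rewrite Rabs_mult, (Rabs_right (/ 2)); lra. }
destruct (Rle_lt_dec 0 (Im z)) as [Hs|Hs].
- exists (sqrt ((m + Re z) / 2), sqrt ((m - Re z) / 2)).
  rewrite Rabs_right in Hpq by lra. apply Ceq_parts; simpl; nra.
- exists (sqrt ((m + Re z) / 2), - sqrt ((m - Re z) / 2)).
  rewrite Rabs_left in Hpq by lra. apply Ceq_parts; simpl; nra.
Qed.

Definition Cexp (z : C) : C := (exp (Re z) * cos (Im z), exp (Re z) * sin (Im z)).

Lemma Cexp_plus (z w : C) : Cexp (z + w) = (Cexp z * Cexp w)%C.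
Proof.
unfold Cexp, Cplus, Cmult, Re, Im; simpl. rewrite exp_plus, cos_plus, sin_plus.
f_equal; ring.
Qed.

Lemma Cexp_0 : Cexp 0 = 1%C.
Proof. unfold Cexp, RtoC, Re, Im; simpl. rewrite exp_0, cos_0, sin_0. f_equal; ring. Qed.

Lemma Cexp_opp_r (z : C) : (Cexp z * Cexp (- z))%C = 1%C.
Proof. rewrite <- Cexp_plus, Cplus_opp_r. apply Cexp_0. Qed.

Lemma Cexp_neq_0 (z : C) : Cexp z <> 0%C.
Proof.
intros H. pose proof (Cexp_opp_r z) as H1. rewrite H, Cmult_0_l in H1.
injection H1. intros; lra.
Qed.

Lemma Cmod_Cexp (z : C) : Cmod (Cexp z) = exp (Re z).
Proof.
unfold Cmod, Cexp; simpl.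
replace (_ + _) with (Rsqr (exp (Re z))).
- apply sqrt_Rsqr, Rlt_le, exp_pos.
- pose proof (sin2_cos2 (Im z)). unfold Rsqr in *.
  transitivity (exp (Re z) * exp (Re z) * (sin (Im z) * sin (Im z) + cos (Im z) * cos (Im z))); [rewrite H|]; ring.
Qed.

(** Mean value theorem, with [cos >= 1 / 2] on [[-1, 1]] because [1 < PI / 3]. *)
Lemma Rabs_sin_lower (t : R) : Rabs t <= 1 -> Rabs t / 2 <= Rabs (sin t).
Proof.
intros Ht. apply Rabs_le_between in Ht.
destruct (MVT_gen sin 0 t cos) as [c [Hc E]].
- intros x _. apply is_derive_Reals, derivable_pt_lim_sin.
- intros x _. apply continuity_sin.
- rewrite sin_0, !Rminus_0_r in E. rewrite E, Rabs_mult.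
  assert (Hcos : 1 / 2 <= cos c).
  { rewrite <- cos_PI3. pose proof PI2_3_2.
    assert (Hc1 : - 1 <= c <= 1).
    { revert Hc. unfold Rmin, Rmax. destruct (Rle_dec 0 t); lra. }
    destruct (Rle_lt_dec 0 c).
    - apply cos_decr_1; lra.
    - rewrite <- (cos_neg c). apply cos_decr_1; lra. }
  rewrite (Rabs_right (cos c)) by lra.
  pose proof (Rabs_pos t). nra.
Qed.

(** For [x < 0], [exp (- x) >= 1 - x] gives [1 - exp x >= - x / (1 - x)], and [1 - x <= 2]. *)
Lemma Rabs_expm1_lower (x : R) : Rabs x <= 1 -> Rabs x / 2 <= Rabs (exp x - 1).
Proof.
intros Hx. apply Rabs_le_between in Hx.
destruct (Rle_lt_dec 0 x) as [H|H].
- pose proof (exp_ineq1_le x). rewrite !Rabs_right by lra. lra.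
- pose proof (exp_ineq1_le (- x)). pose proof (exp_pos x).
  assert (E : exp x * exp (- x) = 1) by (rewrite <- exp_plus, Rplus_opp_r; apply exp_0).
  rewrite !Rabs_left by nra. nra.
Qed.

(** With [w = x + i y], [|e^w - 1|^2 = (e^x - 1)^2 + 4 e^x sin^2 (y / 2)], and the two terms are
    bounded below separately, using [e^x >= 1 + x >= 1 / 2]. *)
Lemma Cmod_Cexp_minus_1_lower (w : C) :
  Cmod w <= 1 / 2 -> Cmod w / 4 <= Cmod (Cexp w - 1).
Proof.
intros Hw.
pose proof (Rmax_Cmod w) as Hmax.
assert (Hx : Rabs (Re w) <= 1 / 2).
{ eapply Rle_trans; [apply Rmax_l|]. eapply Rle_trans; [exact Hmax|exact Hw]. }
assert (Hy : Rabs (Im w) <= 1 / 2).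
{ eapply Rle_trans; [apply Rmax_r|]. eapply Rle_trans; [exact Hmax|exact Hw]. }
pose proof (Rabs_expm1_lower (Re w) ltac:(lra)) as He.
assert (Hy2 : Rabs (Im w / 2) <= 1).
{ unfold Rdiv. rewrite Rabs_mult, (Rabs_right (/ 2)) by lra. lra. }
pose proof (Rabs_sin_lower _ Hy2) as Hs.
assert (He2 : Rsqr (Re w / 2) <= Rsqr (exp (Re w) - 1)).
{ apply Rsqr_le_abs_1. unfold Rdiv. rewrite Rabs_mult, (Rabs_right (/ 2)) by lra. exact He. }
assert (Hs2 : Rsqr (Im w / 4) <= Rsqr (sin (Im w / 2))).
{ apply Rsqr_le_abs_1. unfold Rdiv in *. rewrite Rabs_mult, (Rabs_right (/ 2)) in Hs by lra.
  rewrite Rabs_mult, (Rabs_right (/ 4)) by lra. lra. }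
assert (Hsq : (Cmod w / 4) ^ 2 <= Cmod (Cexp w - 1) ^ 2).
{ replace ((Cmod w / 4) ^ 2) with (Cmod w ^ 2 / 16) by field.
  rewrite !Cmod2_alt. simpl.
  assert (Hc : cos (Im w) = 1 - 2 * Rsqr (sin (Im w / 2))).
  { replace (Im w) with (2 * (Im w / 2)) at 1 by field. rewrite cos_2a_sin. unfold Rsqr. ring. }
  pose proof (sin2_cos2 (Im w)) as Hsc. unfold Rsqr in Hsc.
  pose proof (exp_ineq1_le (Re w)). apply Rabs_le_between in Hx.
  unfold Rsqr in *.
  transitivity ((exp (Re w) - 1) * (exp (Re w) - 1)
     + 4 * exp (Re w) * (sin (Im w / 2) * sin (Im w / 2))).
  - assert (Im w * Im w / 8 <= 4 * exp (Re w) * (sin (Im w / 2) * sin (Im w / 2))); [|nra].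
    transitivity (4 * (1 / 2) * (sin (Im w / 2) * sin (Im w / 2))); [lra|].
    apply Rmult_le_compat_r; [nra|lra].
  - apply Req_le.
    set (e := exp (Re w)) in *. set (sh := sin (Im w / 2)) in *.
    assert (Hs' : sin (Im w) * sin (Im w) = 1 - cos (Im w) * cos (Im w)) by lra.
    transitivity ((e * cos (Im w) - 1) * (e * cos (Im w) - 1) + e * e * (sin (Im w) * sin (Im w))); [|ring].
    rewrite Hs', Hc. ring. }
apply Rsqr_incr_0_var; [unfold Rsqr; lra | apply Cmod_ge_0].
Qed.

Lemma Cmod_Cexp_le_3 (w : C) : Cmod w <= 1 -> Cmod (Cexp w) <= 3.
Proof.
intros Hw. rewrite Cmod_Cexp.
pose proof (re_le_Cmod w) as Hx. apply Rabs_le_between in Hx.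
pose proof exp_le_3.
destruct (Req_dec (Re w) 1) as [->|H1]; [lra|].
apply Rlt_le. eapply Rlt_le_trans; [apply exp_increasing|exact H]. lra.
Qed.

(** Since [|Im w| <= 1 < PI / 2], the real part of [e^w] is nonnegative. *)
Lemma Cmod_Cexp_plus_1_lower (w : C) : Cmod w <= 1 -> 1 <= Cmod (Cexp w + 1).
Proof.
intros Hw.
assert (Hy : Rabs (Im w) <= 1).
{ eapply Rle_trans; [apply Rmax_r|]. eapply Rle_trans; [apply Rmax_Cmod|exact Hw]. }
apply Rabs_le_between in Hy. pose proof PI2_3_2.
assert (0 <= cos (Im w)) by (apply cos_ge_0; lra).
eapply Rle_trans; [|apply re_le_Cmod]. eapply Rle_trans; [|apply Rle_abs].
simpl. pose proof (exp_pos (Re w)). nra.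
Qed.

(** * The characteristic equation *)

(* The sign [s = 1] corresponds to odd, [s = -1] to even eigenfunctions;
   [theta = 0] is always a solution, whether or not 0 is an eigenvalue. *)
Definition char_eq (a : R) (alpha theta s : C) : Prop :=
  (s = 1%C \/ s = (- (1))%C) /\
  ((alpha + theta) * Cexp (2 * a * theta) = s * (alpha - theta))%C.

(** An eigenvalue determines [theta] only up to sign, and the equation respects this: multiply it by
    [s e^(- 2 a theta)] and use [s^2 = 1]. *)
Lemma char_eq_opp (a : R) (alpha theta s : C) :
  char_eq a alpha theta s -> char_eq a alpha (- theta) s.
Proof.
intros [Hs H]. split; [exact Hs|].
replace (2 * a * - theta)%C with (- (2 * a * theta))%C by ring.
assert (Hss : (s * s)%C = 1%C) by (destruct Hs as [-> | ->]; ring).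
transitivity (s * s * (alpha + - theta) * Cexp (- (2 * a * theta)))%C; [rewrite Hss; ring|].
transitivity (s * (s * (alpha - theta)) * Cexp (- (2 * a * theta)))%C; [ring|].
rewrite <- H.
transitivity (s * (alpha + theta) * (Cexp (2 * a * theta) * Cexp (- (2 * a * theta))))%C; [ring|].
rewrite Cexp_opp_r; ring.
Qed.

Lemma char_eq_0 (a : R) (alpha : C) : char_eq a alpha 0 1.
Proof.
split; [now left|]. rewrite Cmult_0_r, Cexp_0. ring.
Qed.

Lemma Cmod_minus_ge (z w : C) : Cmod z - Cmod w <= Cmod (z - w).
Proof.
pose proof (Cmod_triangle (z - w) w) as H.
replace (z - w + w)%C with z in H by ring. lra.
Qed.

(** Eliminating [e^(2 a theta2)] leaves [(q + alpha d) e^w = s1 s2 (q - alpha d)] with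
    [d = theta1 - theta2], [w = 2 a d] and [q = alpha^2 - theta1 theta2]. Here [q] is of order
    [alpha^2], whereas [alpha d] is only of order [alpha], so for large [alpha] this forces
    [d = 0]. *)
Lemma char_eq_unique (a M : R) (alpha theta1 theta2 s1 s2 : C) :
  0 < a -> 16 / a < Cmod alpha -> 2 * M <= Cmod alpha ^ 2 ->
  Cmod theta1 ^ 2 <= M -> Cmod theta2 ^ 2 <= M ->
  4 * a * Cmod (theta1 - theta2) <= 1 ->
  char_eq a alpha theta1 s1 -> char_eq a alpha theta2 s2 ->
  theta1 = theta2.
Proof.
intros Ha Hal HM H1 H2 Hd [Hs1 E1] [Hs2 E2].
set (d := (theta1 - theta2)%C) in *.
set (w := (2 * a * d)%C).
assert (Hw : Cmod w = 2 * a * Cmod d).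
{ unfold w. rewrite !Cmod_mult, !Cmod_R, !Rabs_right by lra. reflexivity. }
assert (E3 : Cexp (2 * a * theta1) = (Cexp (2 * a * theta2) * Cexp w)%C).
{ rewrite <- Cexp_plus. f_equal. unfold w, d. ring. }
rewrite E3 in E1.
set (q := (alpha * alpha - theta1 * theta2)%C).
assert (Ealpha : ((s2 * ((alpha + theta1) * (alpha - theta2))) * Cexp w
         = s1 * ((alpha - theta1) * (alpha + theta2)))%C).
{ transitivity ((alpha + theta1) * (s2 * (alpha - theta2)) * Cexp w)%C; [ring|].
  rewrite <- E2.
  transitivity ((alpha + theta2) * ((alpha + theta1) * (Cexp (2 * a * theta2) * Cexp w)))%C; [ring|].
  rewrite E1. ring. }
replace ((alpha + theta1) * (alpha - theta2))%C with (q + alpha * d)%C in Ealpha by (unfold q, d; ring).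
replace ((alpha - theta1) * (alpha + theta2))%C with (q - alpha * d)%C in Ealpha by (unfold q, d; ring).
assert (Hq : Cmod alpha ^ 2 / 2 <= Cmod q).
{ unfold q. eapply Rle_trans; [|apply Cmod_minus_ge]. rewrite !Cmod_mult.
  pose proof (Cmod_ge_0 theta1). pose proof (Cmod_ge_0 theta2). nra. }
assert (Hpos : 0 < 16 / a) by (apply Rdiv_lt_0_compat; lra).
assert (Hala : 16 < a * Cmod alpha).
{ apply (Rmult_lt_compat_l a) in Hal; [|lra]. replace (a * (16 / a)) with 16 in Hal by (field; lra). lra. }
pose proof (Cmod_ge_0 d) as Hd0.
pose proof (Cmod_Cexp_le_3 w ltac:(lra)) as Hub.
assert (Cases : s1 = s2 \/ s1 = (- s2)%C).
{ destruct Hs1 as [-> | ->], Hs2 as [-> | ->]; [left|right|right|left]; ring. }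
assert (Hss : (s2 * s2)%C = 1%C) by (destruct Hs2 as [-> | ->]; ring).
assert (Hd1 : Cmod d = 0).
{ destruct Cases as [-> | ->].
  (* Equal signs: the left side is at least [a |alpha|^2 |d| / 4] and the right side at most
     [4 |alpha| |d|]. A nonzero [d] would give [a |alpha| <= 16]. *)
  - assert (E : (q * (Cexp w - 1) = - (alpha * d * (Cexp w + 1)))%C).
    { transitivity (s2 * (s2 * (q + alpha * d) * Cexp w) - q - alpha * d * Cexp w)%C;
        [transitivity (s2 * s2 * ((q + alpha * d) * Cexp w) - q - alpha * d * Cexp w)%C; [rewrite Hss|]; ring|].
      rewrite Ealpha.
      transitivity (s2 * s2 * (q - alpha * d) - q - alpha * d * Cexp w)%C; [ring|].
      rewrite Hss. ring. }
    apply (f_equal Cmod) in E. rewrite Cmod_opp, !Cmod_mult in E.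
    pose proof (Cmod_triangle (Cexp w) 1) as Ht. rewrite Cmod_1 in Ht.
    pose proof (Cmod_Cexp_minus_1_lower w ltac:(lra)) as Hlow. rewrite Hw in Hlow.
    assert (L : Cmod alpha ^ 2 / 2 * (2 * a * Cmod d / 4) <= Cmod alpha * Cmod d * 4).
    { transitivity (Cmod q * Cmod (Cexp w - 1)).
      - apply Rmult_le_compat; nra.
      - rewrite E. apply Rmult_le_compat_l; [|lra]. apply Rmult_le_pos; lra. }
    assert (L2 : (Cmod alpha * Cmod d) * (a * Cmod alpha - 16) <= 0) by lra.
    destruct (Rle_lt_or_eq_dec _ _ Hd0) as [Hlt|]; [|congruence].
    assert (0 < Cmod alpha * Cmod d * (a * Cmod alpha - 16)); [|lra].
    repeat apply Rmult_lt_0_compat; lra.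
  (* Opposite signs are impossible: [e^w + 1] stays away from 0, so [|alpha| <= 8 |d| <= 2 / a],
     against [|alpha| > 16 / a]. *)
  - assert (E : (q * (Cexp w + 1) = alpha * d * (1 - Cexp w))%C).
    { transitivity (s2 * (s2 * (q + alpha * d) * Cexp w) + q - alpha * d * Cexp w)%C;
        [transitivity (s2 * s2 * ((q + alpha * d) * Cexp w) + q - alpha * d * Cexp w)%C; [rewrite Hss|]; ring|].
      rewrite Ealpha.
      transitivity (- (s2 * s2 * (q - alpha * d)) + q - alpha * d * Cexp w)%C; [ring|].
      rewrite Hss. ring. }
    apply (f_equal Cmod) in E. rewrite !Cmod_mult in E.
    pose proof (Cmod_triangle 1 (- Cexp w)) as Ht. rewrite Cmod_1, Cmod_opp in Ht.
    fold (1 - Cexp w)%C in Ht.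
    pose proof (Cmod_Cexp_plus_1_lower w ltac:(lra)) as Hlow.
    assert (L : Cmod alpha ^ 2 / 2 * 1 <= Cmod alpha * Cmod d * 4).
    { transitivity (Cmod q * Cmod (Cexp w + 1)).
      - apply Rmult_le_compat; nra.
      - rewrite E. apply Rmult_le_compat_l; [|lra]. apply Rmult_le_pos; lra. }
    assert (L2 : Cmod alpha * (Cmod alpha - 8 * Cmod d) <= 0) by lra.
    assert (0 < Cmod alpha * (Cmod alpha - 8 * Cmod d)); [|lra].
    apply Rmult_lt_0_compat; [lra|]. nra. }
apply Cmod_eq_0 in Hd1. unfold d in Hd1.
replace theta1 with (theta1 - theta2 + theta2)%C by ring. rewrite Hd1. ring.
Qed.

(** * Complex functions of a real variable *)

(** Composing with this projection onto [[lo, hi]] extends a function by constants to the whole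
    line, where the mean value and intermediate value theorems are applied. *)
Definition clamp (lo hi x : R) : R := Rmax lo (Rmin x hi).

Lemma clamp_in (lo hi x : R) : lo <= hi -> segment lo hi (clamp lo hi x).
Proof.
intros H. unfold segment, clamp, Rmax, Rmin.
destruct (Rle_dec x hi); destruct (Rle_dec lo _); lra.
Qed.

Lemma clamp_id (lo hi x : R) : segment lo hi x -> clamp lo hi x = x.
Proof.
unfold segment, clamp, Rmax, Rmin.
intros H. destruct (Rle_dec x hi); destruct (Rle_dec lo _); lra.
Qed.

Lemma clamp_lipschitz (lo hi x y : R) :
  Rabs (clamp lo hi y - clamp lo hi x) <= Rabs (y - x).
Proof.
unfold clamp, Rmax, Rmin.
destruct (Rle_dec x hi), (Rle_dec y hi); repeat destruct (Rle_dec lo _);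
  unfold Rabs; repeat destruct Rcase_abs; lra.
Qed.

Lemma continuous_clamp {U : UniformSpace} (lo hi : R) (f : R -> U) (x : R) :
  lo <= hi -> continuous_on (segment lo hi) f ->
  continuous (fun t => f (clamp lo hi t)) x.
Proof.
intros H Hf P HP.
destruct (Hf _ (clamp_in lo hi x H) P HP) as [eps Heps].
exists eps. intros y Hy. apply Heps.
- eapply Rle_lt_trans; [apply clamp_lipschitz|exact Hy].
- now apply clamp_in.
Qed.

Lemma continuous_C_parts {T : UniformSpace} (f : T -> C) (x : T) :
  continuous f x <->
  continuous (fun t => Re (f t)) x /\ continuous (fun t => Im (f t)) x.
Proof.
split.
- intros H. split.
  + apply (continuous_comp f Re); [exact H|apply continuous_fst].
  + apply (continuous_comp f Im); [exact H|apply continuous_snd].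
- intros [H1 H2]. apply filterlim_locally. intros eps.
  generalize (filter_and _ _ (proj1 (filterlim_locally _ _) H1 eps)
    (proj1 (filterlim_locally _ _) H2 eps)).
  apply filter_imp. intros y [A B]. split; [exact A|exact B].
Qed.

Lemma continuous_Cmult {T : UniformSpace} (f g : T -> C) (x : T) :
  continuous f x -> continuous g x -> continuous (fun t => Cmult (f t) (g t)) x.
Proof.
intros Hf Hg.
apply continuous_C_parts in Hf, Hg. destruct Hf as [Hf1 Hf2], Hg as [Hg1 Hg2].
apply continuous_C_parts. split.
- apply (continuous_minus (V := R_NormedModule)); apply (continuous_mult (K := R_AbsRing)); assumption.
- apply (continuous_plus (V := R_NormedModule)); apply (continuous_mult (K := R_AbsRing)); assumption.
Qed.

Lemma is_derive_C_parts (f : R -> C) (x : R) (l : C) :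
  @is_derive R_AbsRing C_R_NormedModule f x l <->
  is_derive (fun t => Re (f t)) x (Re l) /\ is_derive (fun t => Im (f t)) x (Im l).
Proof.
split.
- intros H. split.
  + exact (filterdiff_comp' f Re x _ Re H (filterdiff_linear _ is_linear_fst)).
  + exact (filterdiff_comp' f Im x _ Im H (filterdiff_linear _ is_linear_snd)).
- intros [H1 H2].
  pose proof (filterdiff_comp'_2 _ _ (fun a b => (a, b)) x _ _ (fun a b => (a, b)) H1 H2) as H.
  eapply filterdiff_ext; [|eapply filterdiff_ext_lin; [apply H|]].
  + intros y. simpl. now rewrite <- surjective_pairing.
  + apply (filterdiff_ext_lin _ (fun t => t)); [|now intros []].
    eapply filterdiff_ext; [|apply filterdiff_id]. now intros [].
  + intros y. reflexivity.
Qed.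

Lemma is_derive_Cmult (f g : R -> C) (x : R) (f' g' : C) :
  @is_derive R_AbsRing C_R_NormedModule f x f' ->
  @is_derive R_AbsRing C_R_NormedModule g x g' ->
  @is_derive R_AbsRing C_R_NormedModule (fun t => Cmult (f t) (g t)) x
    (f' * g x + f x * g')%C.
Proof.
rewrite !is_derive_C_parts. intros [F1 F2] [G1 G2].
assert (M : forall p q : R -> R, forall p' q' : R,
  is_derive p x p' -> is_derive q x q' ->
  is_derive (fun t => p t * q t) x (p' * q x + p x * q')).
{ intros p q p' q' Hp Hq. exact (is_derive_mult p q x p' q' Hp Hq Rmult_comm). }
split.
- pose proof (is_derive_minus _ _ _ _ _ (M _ _ _ _ F1 G1) (M _ _ _ _ F2 G2)) as H.
  evar_last; [exact H|].
  unfold minus, plus, opp; simpl. unfold Re, Im. ring.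
- pose proof (is_derive_plus _ _ _ _ _ (M _ _ _ _ F1 G2) (M _ _ _ _ F2 G1)) as H.
  evar_last; [exact H|].
  unfold plus; simpl. unfold Re, Im. ring.
Qed.

Lemma is_derive_Cminus (f g : R -> C) (x : R) (f' g' : C) :
  @is_derive R_AbsRing C_R_NormedModule f x f' ->
  @is_derive R_AbsRing C_R_NormedModule g x g' ->
  @is_derive R_AbsRing C_R_NormedModule (fun t => Cminus (f t) (g t)) x (f' - g')%C.
Proof. exact (is_derive_minus (V := C_R_NormedModule) f g x f' g'). Qed.

Lemma is_derive_Cexp (theta : C) (x : R) :
  @is_derive R_AbsRing C_R_NormedModule (fun t : R => Cexp (theta * t)) x
    (theta * Cexp (theta * x))%C.
Proof.
apply is_derive_C_parts. destruct theta as [p q].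
unfold Cexp, Cmult, RtoC, Re, Im; simpl. split; auto_derive; auto; unfold Rminus; ring.
Qed.

Lemma continuous_Cexp (theta : C) (x : R) :
  continuous (fun t : R => Cexp (theta * t)) x.
Proof.
apply (ex_derive_continuous (V := C_R_NormedModule)).
eexists. apply is_derive_Cexp.
Qed.

(** * Derivatives relative to an interval and first integrals *)

(** [filterdiff] asks for an estimate at every limit of the filter, and a finer filter may have more
    limits; hence the condition on limits besides [filter_le]. *)
Lemma filterdiff_filter_le {K : AbsRing} {U V : NormedModule K}
    (F G : (U -> Prop) -> Prop) (f l : U -> V) :
  filter_le F G -> (forall x, is_filter_lim F x -> is_filter_lim G x) ->
  filterdiff f G l -> filterdiff f F l.
Proof.
intros HFG Hlim [Hl Hd]. split; [exact Hl|].
intros x Hx eps. apply HFG. now apply (Hd x (Hlim x Hx)).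
Qed.

Lemma is_derive_within_interior (D : R -> Prop) (f : R -> C) (x : R) (l : C) :
  locally x D -> is_derive_within D f x l ->
  @is_derive R_AbsRing C_R_NormedModule f x l.
Proof.
intros HD. apply filterdiff_filter_le.
- intros P HP. generalize (filter_and _ _ HD HP). apply filter_imp. intros y [A B]. auto.
- intros y Hy P HP. apply filter_le_within. now apply Hy.
Qed.

Lemma is_derive_is_derive_within (D : R -> Prop) (f : R -> C) (x : R) (l : C) :
  D x -> @is_derive R_AbsRing C_R_NormedModule f x l -> is_derive_within D f x l.
Proof.
intros HD. apply filterdiff_filter_le.
- apply filter_le_within.
- intros y Hy.
  (* As [x] lies in [D], every set of the restricted filter contains [x], so [x] is its only
     limit. *)
  assert (y = x) as ->; [|intros P HP; exact HP].
  apply eq_close. intros eps.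
  destruct (Hy (ball y eps) (locally_ball y eps)) as [d Hd].
  exact (Hd x (ball_center x d) HD).
Qed.

Lemma is_derive_within_continuous (D : R -> Prop) (f : R -> C) (x : R) (l : C) :
  is_derive_within D f x l -> filterlim f (within D (locally x)) (locally (f x)).
Proof.
intros H.
refine (@filterdiff_continuous_aux _ _ C_R_NormedModule _ _ f _ x _).
- eexists; exact H.
- apply filter_le_within.
Qed.

Lemma is_derive_within_clamp (lo hi : R) (f f' : R -> C) :
  lo < hi ->
  (forall x, segment lo hi x -> is_derive_within (segment lo hi) f x (f' x)) ->
  (forall x, continuous (fun t => f (clamp lo hi t)) x) /\
  (forall x, lo < x < hi ->
    @is_derive R_AbsRing C_R_NormedModule (fun t => f (clamp lo hi t)) x (f' x)).
Proof.
intros Hlh H. split.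
- intros x. apply continuous_clamp; [lra|].
  intros y Hy. apply (is_derive_within_continuous _ _ _ _ (H y Hy)).
- intros x Hx.
  assert (HD : locally x (segment lo hi)).
  { generalize (filter_and _ _ (open_gt lo x (proj1 Hx)) (open_lt hi x (proj2 Hx))).
    apply filter_imp. unfold segment. intros y Hy; lra. }
  apply (is_derive_ext_loc (V := C_R_NormedModule) f).
  + revert HD. apply filter_imp. intros y Hy. now rewrite clamp_id.
  + apply (is_derive_within_interior _ _ _ _ HD), H. unfold segment; lra.
Qed.

Lemma is_derive_0_constant (lo hi : R) (f : R -> R) :
  (forall x, continuous f x) -> (forall x, lo < x < hi -> is_derive f x 0) ->
  forall x y, segment lo hi x -> segment lo hi y -> f x = f y.
Proof.
intros Hc Hd x y Hx Hy. unfold segment in *.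
destruct (MVT_gen f x y (fun _ => 0)) as [c [_ E]].
- intros t Ht. apply Hd. revert Ht. unfold Rmin, Rmax. destruct (Rle_dec x y); lra.
- intros t _. apply continuity_pt_filterlim, Hc.
- simpl in E. lra.
Qed.

Lemma is_derive_0_constant_C (lo hi : R) (f : R -> C) :
  (forall x, continuous f x) ->
  (forall x, lo < x < hi -> @is_derive R_AbsRing C_R_NormedModule f x (RtoC 0)) ->
  forall x y, segment lo hi x -> segment lo hi y -> f x = f y.
Proof.
intros Hc Hd x y Hx Hy. apply Ceq_parts.
- apply (is_derive_0_constant lo hi (fun t => Re (f t))); try assumption.
  + intros t. apply (continuous_C_parts f t), Hc.
  + intros t Ht. apply (proj1 (is_derive_C_parts f t (RtoC 0))), Hd, Ht.
- apply (is_derive_0_constant lo hi (fun t => Im (f t))); try assumption.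
  + intros t. apply (continuous_C_parts f t), Hc.
  + intros t Ht. apply (proj1 (is_derive_C_parts f t (RtoC 0))), Hd, Ht.
Qed.

(** The derivative is [(u2 - theta^2 u) e^(theta x) = 0]. Applied below to both square roots of
    [- lam], and to [theta = 0], where it says that [u1] is constant. *)
Lemma first_integral (lo hi : R) (theta : C) (u u1 u2 : R -> C) :
  lo < hi ->
  (forall x, segment lo hi x -> is_derive_within (segment lo hi) u x (u1 x)) ->
  (forall x, segment lo hi x -> is_derive_within (segment lo hi) u1 x (u2 x)) ->
  (forall x, lo < x < hi -> u2 x = (theta * theta * u x)%C) ->
  forall x y, segment lo hi x -> segment lo hi y ->
  ((u1 x - theta * u x) * Cexp (theta * x))%C = ((u1 y - theta * u y) * Cexp (theta * y))%C.
Proof.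
intros Hlh Hu Hu1 Hode x y Hx Hy.
destruct (is_derive_within_clamp lo hi u u1 Hlh Hu) as [Cu Du].
destruct (is_derive_within_clamp lo hi u1 u2 Hlh Hu1) as [Cu1 Du1].
pose (v := fun t : R => ((u1 (clamp lo hi t) - theta * u (clamp lo hi t)) * Cexp (theta * t))%C).
assert (E : v x = v y).
{ apply (is_derive_0_constant_C lo hi v); try assumption.
  - intros t. apply continuous_Cmult; [|apply continuous_Cexp].
    apply (continuous_minus (V := C_R_NormedModule)); [apply Cu1|].
    apply continuous_Cmult; [apply continuous_const|apply Cu].
  - intros t Ht.
    assert (Hz : @is_derive R_AbsRing C_R_NormedModule (fun _ => theta) t (RtoC 0))
      by apply (is_derive_const (V := C_R_NormedModule)).
    pose proof (is_derive_Cmult _ _ t _ _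
      (is_derive_Cminus _ _ t _ _ (Du1 t Ht)
        (is_derive_Cmult _ _ t _ _ Hz (Du t Ht)))
      (is_derive_Cexp theta t)) as H.
    evar_last; [exact H|].
    cbv beta. rewrite clamp_id by (unfold segment; lra). rewrite Hode by exact Ht.
    ring. }
unfold v in E. now rewrite !clamp_id in E by assumption.
Qed.

(** * Eigenvalues near infinity *)

Lemma second_derivative_root (lam theta u u2 : C) :
  (theta * theta = - lam)%C -> (- u2 = lam * u)%C -> (u2 = theta * theta * u)%C.
Proof.
intros Ht H. rewrite Ht.
replace u2 with (- - u2)%C by ring. rewrite H. ring.
Qed.

(** For eigenvalue 0, [u] is affine with slope [k], and subtracting the boundary conditions gives
    [2 k (1 + alpha a) = 0]. If [k = 0] then [u] vanishes since [alpha <> 0]; otherwise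
    [|alpha| = 1 / a]. *)
Lemma robin_eigenvalue_neq_0 (a : R) (alpha : C) :
  0 < a -> 1 / a < Cmod alpha -> ~ robin_eigenvalue a alpha 0.
Proof.
intros Ha Hal [u [u1 [u2 [[Hu [Hu1 _]] [[x0 [Hx0 Hne]] [Hode [BCl BCr]]]]]]].
assert (Sa : segment (- a) a a) by (unfold segment; lra).
assert (Sma : segment (- a) a (- a)) by (unfold segment; lra).
assert (Hinv : 0 < 1 / a) by (apply Rdiv_lt_0_compat; lra).
assert (Hal0 : alpha <> 0%C).
{ intros ->. rewrite Cmod_0 in Hal. lra. }
set (k := u1 a).
assert (Hk : forall x, segment (- a) a x -> u1 x = k).
{ intros x Hx.
  pose proof (first_integral (- a) a 0 u u1 u2 ltac:(lra) Hu Hu1) as F.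
  assert (E : ((u1 x - 0 * u x) * Cexp (0 * x) = (u1 a - 0 * u a) * Cexp (0 * a))%C).
  { apply F; try assumption. intros y Hy.
    apply (second_derivative_root 0); [ring|now apply Hode]. }
  rewrite !Cmult_0_l, Cexp_0 in E. unfold k.
  transitivity ((u1 x - 0) * 1)%C; [ring|]. rewrite E. ring. }
destruct (is_derive_within_clamp (- a) a u u1 ltac:(lra) Hu) as [Cu Du].
assert (Haff : forall x y, segment (- a) a x -> segment (- a) a y ->
  (u x - k * x = u y - k * y)%C).
{ intros x y Hx Hy.
  assert (E : (u (clamp (- a) a x) - k * x = u (clamp (- a) a y) - k * y)%C).
  - apply (is_derive_0_constant_C (- a) a (fun t : R => (u (clamp (- a) a t) - k * t)%C)); try assumption.
    + intros t. apply (continuous_minus (V := C_R_NormedModule)); [apply Cu|].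
      apply continuous_Cmult; [apply continuous_const|].
      apply continuous_C_parts. split; [apply continuous_id|apply continuous_const].
    + intros t Ht.
      assert (Hz : @is_derive R_AbsRing C_R_NormedModule (fun _ => k) t (RtoC 0))
        by apply (is_derive_const (V := C_R_NormedModule)).
      assert (Hid : @is_derive R_AbsRing C_R_NormedModule (fun t : R => RtoC t) t (RtoC 1)).
      { apply is_derive_C_parts. split; [exact (is_derive_id (K := R_AbsRing) t)|exact (is_derive_const (V := R_NormedModule) 0 t)]. }
      pose proof (is_derive_Cminus _ _ t _ _ (Du t Ht)
        (is_derive_Cmult _ _ t _ _ Hz Hid)) as H.
      evar_last; [exact H|].
      cbv beta. rewrite Hk by (unfold segment; lra).
      ring.
  - now rewrite !clamp_id in E by assumption. }
rewrite Hk in BCl by assumption. fold k in BCr.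
pose proof (Haff a (- a) Sa Sma) as E. rewrite RtoC_opp in E.
destruct (Ceq_dec k 0) as [Hk0|Hk0].
- apply Hne.
  assert (Hua : u a = 0%C).
  { rewrite Hk0, Cplus_0_l in BCr. destruct (Cmult_eq_0 _ _ BCr); [contradiction|assumption]. }
  pose proof (Haff x0 a Hx0 Sa) as E0. rewrite Hk0, Hua in E0.
  transitivity (u x0 - 0 * x0)%C; [ring|]. rewrite E0. ring.
- assert (P : (k * (1 + alpha * a) = 0)%C).
  { assert (Hd : (u a = u (- a)%R + 2 * (k * a))%C).
    { transitivity (u a - k * a + k * a)%C; [ring|]. rewrite E. ring. }
    rewrite Hd in BCr.
    assert (H2 : (2 * (k * (1 + alpha * a)) = 0)%C).
    { transitivity ((k + alpha * (u (- a)%R + 2 * (k * a))) - (- k + alpha * u (- a)%R))%C; [ring|].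
      rewrite BCr, BCl. ring. }
    destruct (Cmult_eq_0 _ _ H2) as [H0|H0]; [|exact H0].
    apply RtoC_inj in H0. lra. }
  destruct (Cmult_eq_0 _ _ P) as [H0|H0]; [contradiction|].
  assert (Hm : (alpha * a = - (1))%C).
  { transitivity (1 + alpha * a - 1)%C; [ring|]. rewrite H0. ring. }
  apply (f_equal Cmod) in Hm.
  rewrite Cmod_m1, Cmod_mult, Cmod_R, Rabs_right in Hm by lra.
  apply (Rmult_lt_compat_r a) in Hal; [|lra]. rewrite Hm in Hal.
  replace (1 / a * a) with 1 in Hal by (field; lra). lra.
Qed.

(** The first integrals for [theta] and [- theta], compared at the endpoints, form a linear system
    in [u a] and [u (- a)]. It decouples into the even part [y + w] and the odd part [y - w]; a
    nonzero part makes its factor vanish, giving [s = -1] or [s = 1]. *)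
Lemma robin_eigenvalue_char_eq (a : R) (alpha lam theta : C) :
  0 < a -> theta <> 0%C -> (theta * theta = - lam)%C ->
  robin_eigenvalue a alpha lam -> exists s, char_eq a alpha theta s.
Proof.
intros Ha Hth Hlam [u [u1 [u2 [[Hu [Hu1 _]] [[x0 [Hx0 Hne]] [Hode [BCl BCr]]]]]]].
assert (Sa : segment (- a) a a) by (unfold segment; lra).
assert (Sma : segment (- a) a (- a)) by (unfold segment; lra).
assert (F : forall eta, (eta * eta = - lam)%C -> forall x y, segment (- a) a x -> segment (- a) a y ->
  ((u1 x - eta * u x) * Cexp (eta * x))%C = ((u1 y - eta * u y) * Cexp (eta * y))%C).
{ intros eta Heta. apply (first_integral _ _ _ u u1 u2); try assumption; [lra|].
  intros x Hx. apply (second_derivative_root lam); [exact Heta|now apply Hode]. }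
assert (Hopp : (- theta * - theta = - lam)%C) by (rewrite <- Hlam; ring).
assert (BCr' : u1 a = (- (alpha * u a))%C).
{ transitivity (u1 a + alpha * u a - alpha * u a)%C; [ring|]. rewrite BCr. ring. }
assert (BCl' : u1 (- a) = (alpha * u (- a)%R)%C).
{ transitivity (alpha * u (- a)%R - (- u1 (- a)%R + alpha * u (- a)%R))%C; [ring|]. rewrite BCl. ring. }
pose proof (F theta Hlam a (- a) Sa Sma) as F1.
pose proof (F (- theta)%C Hopp a (- a) Sa Sma) as F2.
rewrite RtoC_opp, BCr', BCl' in F1, F2.
set (y := u a) in *. set (w := u (- a)) in *.
set (E := Cexp (theta * a)) in *.
set (E' := Cexp (- (theta * a))).
replace (theta * - a)%C with (- (theta * a))%C in F1 by ring. fold E' in F1.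
replace (- theta * a)%C with (- (theta * a))%C in F2 by ring. fold E' in F2.
replace (- theta * - a)%C with (theta * a)%C in F2 by ring. fold E in F2.
assert (EE : (E * E' = 1)%C) by apply Cexp_opp_r.
assert (E2 : Cexp (2 * a * theta) = (E * E)%C).
{ unfold E. rewrite <- Cexp_plus. f_equal. ring. }
assert (HS : ((y + w) * ((alpha + theta) * (E * E) + (alpha - theta)) = 0)%C).
{ transitivity (E * (- ((- (alpha * y) - theta * y) * E - (alpha * w - theta * w) * E')
    - ((- (alpha * y) - - theta * y) * E' - (alpha * w - - theta * w) * E))
    + (alpha - theta) * (y + w) * (1 - E * E'))%C; [ring|].
  rewrite F1, F2, EE. ring. }
assert (HT : ((y - w) * ((alpha + theta) * (E * E) - (alpha - theta)) = 0)%C).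
{ transitivity (E * (- ((- (alpha * y) - theta * y) * E - (alpha * w - theta * w) * E')
    + ((- (alpha * y) - - theta * y) * E' - (alpha * w - - theta * w) * E))
    - (alpha - theta) * (y - w) * (1 - E * E'))%C; [ring|].
  rewrite F1, F2, EE. ring. }
destruct (Cmult_eq_0 _ _ HS) as [S0|S0].
2:{ exists (- (1))%C. split; [now right|]. rewrite E2.
  transitivity ((alpha + theta) * (E * E) + (alpha - theta) - (alpha - theta))%C; [ring|]. rewrite S0. ring. }
destruct (Cmult_eq_0 _ _ HT) as [T0|T0].
2:{ exists 1%C. split; [now left|]. rewrite E2.
  transitivity ((alpha + theta) * (E * E) - (alpha - theta) + (alpha - theta))%C; [ring|]. rewrite T0. ring. }
(* Both parts vanish, so [u] and [u1] are zero at [a] and so are both first integrals. Subtracting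
   them at [x0] gives [theta u x0 = 0]. *)
exfalso. apply Hne.
assert (H2 : RtoC 2 <> 0%C) by (intros H; apply RtoC_inj in H; lra).
assert (Y0 : y = 0%C).
{ assert (H : (2 * y = 0)%C).
  { transitivity ((y + w) + (y - w))%C; [ring|]. rewrite S0, T0. ring. }
  now destruct (Cmult_eq_0 _ _ H). }
assert (V : forall eta, (eta * eta = - lam)%C -> (u1 x0 - eta * u x0 = 0)%C).
{ intros eta Heta. pose proof (F eta Heta x0 a Hx0 Sa) as H.
  fold y in H. rewrite BCr', Y0 in H.
  assert (H0 : ((u1 x0 - eta * u x0) * Cexp (eta * x0) = 0)%C) by (rewrite H; ring).
  destruct (Cmult_eq_0 _ _ H0) as [H1|H1]; [exact H1|]. now apply Cexp_neq_0 in H1. }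
pose proof (V _ Hlam) as V1. pose proof (V _ Hopp) as V2.
assert (H : (2 * (theta * u x0) = 0)%C).
{ transitivity ((u1 x0 - - theta * u x0) - (u1 x0 - theta * u x0))%C; [ring|]. rewrite V1, V2. ring. }
destruct (Cmult_eq_0 _ _ H) as [H0|H0]; [contradiction|].
now destruct (Cmult_eq_0 _ _ H0).
Qed.

(** * Localisation and separation of bounded eigenvalues for large parameter *)

Lemma cos_shift_2kPI (y : R) (k : Z) : cos (y - 2 * (IZR k * PI)) = cos y.
Proof.
assert (H : sin (IZR k * PI) = 0) by (apply sin_eq_0_1; now exists k).
rewrite cos_minus, cos_2a_sin, sin_2a, H. ring.
Qed.

Lemma Cmod_le_parts (z : C) : Cmod z <= Rabs (Re z) + Rabs (Im z).
Proof.
replace z with (RtoC (Re z) + Ci * RtoC (Im z))%C at 1.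
- eapply Rle_trans; [apply Cmod_triangle|].
  rewrite Cmod_mult, Cmod_Ci, !Cmod_R. lra.
- apply Ceq_parts; unfold Re, Im; simpl; ring.
Qed.

(** The modulus [e^(Re w)] near 1 makes [Re w] small; then [cos (Im w)] is near 1, which puts [Im w]
    near a multiple of [2 PI]. *)
Lemma Cexp_near_1 (eps : R) : 0 < eps ->
  exists delta, 0 < delta /\ forall w, Cmod (Cexp w - 1) < delta ->
  exists k : Z, Cmod (w - Ci * RtoC (2 * (IZR k * PI))) < eps.
Proof.
intros Heps.
set (e := Rmin (eps / 2) 1).
assert (He : 0 < e) by (apply Rmin_glb_lt; lra).
assert (He1 : e <= 1) by apply Rmin_r.
assert (He2 : e <= eps / 2) by apply Rmin_l.
pose proof PI2_3_2 as HPI.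
assert (Hcos : cos e < 1).
{ rewrite <- cos_0. apply cos_decreasing_1; lra. }
(* [e / 2] controls [Re w]; [(1 - cos e) / 2] gives [(1 + delta) cos e < 1 - delta], hence the bound
   on the cosine; [1 / 4] keeps [1 - delta] positive. *)
set (delta := Rmin (e / 2) (Rmin ((1 - cos e) / 2) (1 / 4))).
assert (Hd1 : delta <= e / 2) by apply Rmin_l.
assert (Hd2 : delta <= (1 - cos e) / 2) by (eapply Rle_trans; [apply Rmin_r|apply Rmin_l]).
assert (Hd3 : delta <= 1 / 4) by (eapply Rle_trans; [apply Rmin_r|apply Rmin_r]).
assert (Hd : 0 < delta) by (repeat apply Rmin_glb_lt; lra).
exists delta. split; [exact Hd|]. intros w Hw.
assert (Hm : Rabs (exp (Re w) - 1) < delta).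
{ rewrite <- Cmod_Cexp. apply Rabs_def1.
  - pose proof (Cmod_minus_ge (Cexp w) 1) as H. rewrite Cmod_1 in H. lra.
  - pose proof (Cmod_minus_ge 1 (1 - Cexp w)) as H. rewrite Cmod_1 in H.
    replace (1 - (1 - Cexp w))%C with (Cexp w) in H by ring.
    replace (1 - Cexp w)%C with (- (Cexp w - 1))%C in H by ring.
    rewrite Cmod_opp in H. lra. }
assert (Hx : Rabs (Re w) < e).
{ apply Rabs_def2 in Hm. apply Rabs_def1; apply Rnot_le_lt; intros H.
  - pose proof (exp_ineq1_le (Re w)). lra.
  - pose proof (Rabs_expm1_lower (- e)) as L. rewrite Rabs_Ropp, Rabs_right in L by lra.
    specialize (L He1).
    assert (exp (Re w) <= exp (- e)).
    { destruct (Req_dec (Re w) (- e)) as [->|]; [lra|]. apply Rlt_le, exp_increasing. lra. }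
    assert (exp (- e) < 1) by (rewrite <- exp_0; apply exp_increasing; lra).
    rewrite Rabs_left in L by lra. lra. }
assert (Hc : cos e < cos (Im w)).
{ pose proof (re_le_Cmod (Cexp w - 1)) as H. apply Rabs_le_between in H.
  assert (H' : - delta < exp (Re w) * cos (Im w) - 1).
  { replace (exp (Re w) * cos (Im w) - 1) with (Re (Cexp w - 1)) by (unfold Cexp, Re, Im; simpl; ring). lra. }
  apply Rabs_def2 in Hm. pose proof (exp_pos (Re w)).
  apply Rnot_le_lt. intros Hle.
  destruct (Rle_lt_dec (cos (Im w)) 0) as [Hn|Hp]; nra. }
(* [k] is a nearest integer to [Im w / (2 PI)], so the remainder [r] lies in [[- PI, PI]], where
   [cos e < cos r] implies [|r| < e]. *)
destruct (archimed (Im w / (2 * PI) - 1 / 2)) as [Hk1 Hk2].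
set (k := up (Im w / (2 * PI) - 1 / 2)) in *.
assert (Hq : Im w = (Im w / (2 * PI)) * (2 * PI)) by (field; lra).
exists k.
rewrite <- (cos_shift_2kPI (Im w) k) in Hc.
set (r := Im w - 2 * (IZR k * PI)) in *.
assert (Hr : Rabs r <= PI).
{ apply Rabs_le. unfold r. set (q := Im w / (2 * PI)) in *.
  replace (Im w - 2 * (IZR k * PI)) with (2 * PI * (q - IZR k)) by (rewrite Hq; ring).
  assert (- (1 / 2) <= q - IZR k <= 1 / 2) by lra. split; nra. }
assert (Hr2 : Rabs r < e).
{ apply Rnot_le_lt. intros H.
  assert (cos (Rabs r) = cos r) by (unfold Rabs; destruct (Rcase_abs r); [apply cos_neg|reflexivity]).
  assert (cos (Rabs r) <= cos e) by (apply cos_decr_1; lra). lra. }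
eapply Rle_lt_trans; [apply Cmod_le_parts|].
replace (Re (w - Ci * RtoC (2 * (IZR k * PI)))) with (Re w) by (unfold Re; simpl; ring).
replace (Im (w - Ci * RtoC (2 * (IZR k * PI)))) with r by (unfold r, Im; simpl; ring).
lra.
Qed.

(** The equation reads [(alpha + theta) (e^(2 a theta) - s) = - 2 s theta], so [e^(2 a theta)] is
    close to [s]; squaring removes the sign. Here [M] bounds [|theta|], not its square. *)
Lemma char_eq_Cexp_near_1 (a M : R) (alpha theta s : C) :
  0 < Cmod alpha -> 2 * M <= Cmod alpha -> Cmod theta <= M ->
  char_eq a alpha theta s ->
  Cmod (Cexp (4 * a * theta) - 1) <= 16 * M / Cmod alpha.
Proof.
intros Hal HM Hth [Hs E].
set (E2 := Cexp (2 * a * theta)) in *.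
assert (E4 : Cexp (4 * a * theta) = (E2 * E2)%C).
{ unfold E2. rewrite <- Cexp_plus. f_equal. ring. }
assert (Hss : (s * s)%C = 1%C) by (destruct Hs as [-> | ->]; ring).
assert (Hs1 : Cmod s = 1).
{ destruct Hs as [-> | ->]; [apply Cmod_1|apply Cmod_m1]. }
assert (H1 : ((alpha + theta) * (E2 - s) = - (2 * (s * theta)))%C).
{ transitivity ((alpha + theta) * E2 - s * (alpha + theta))%C; [ring|]. rewrite E. ring. }
apply (f_equal Cmod) in H1.
rewrite Cmod_opp, !Cmod_mult, Hs1, Cmod_R, Rabs_right in H1 by lra.
assert (Hlow : Cmod alpha / 2 <= Cmod (alpha + theta)).
{ pose proof (Cmod_minus_ge alpha (- theta)) as H. rewrite Cmod_opp in H.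
  replace (alpha - - theta)%C with (alpha + theta)%C in H by ring. lra. }
pose proof (Cmod_ge_0 (E2 - s)) as H0. pose proof (Cmod_ge_0 theta) as Hth0.
assert (Hd : Cmod (E2 - s) <= 4 * M / Cmod alpha).
{ apply Rmult_le_reg_l with (Cmod alpha / 2); [lra|].
  replace (Cmod alpha / 2 * (4 * M / Cmod alpha)) with (2 * M) by (field; lra).
  transitivity (Cmod (alpha + theta) * Cmod (E2 - s)); [|lra].
  now apply Rmult_le_compat_r. }
assert (Hd2 : 4 * M / Cmod alpha <= 2).
{ apply Rmult_le_reg_r with (Cmod alpha); [lra|]. unfold Rdiv. rewrite Rmult_assoc, Rinv_l by lra. lra. }
assert (Hsum : Cmod (E2 + s) <= 4).
{ replace (E2 + s)%C with ((E2 - s) + 2 * s)%C by ring.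
  eapply Rle_trans; [apply Cmod_triangle|].
  rewrite Cmod_mult, Hs1, Cmod_R, Rabs_right by lra. lra. }
rewrite E4.
replace (E2 * E2 - 1)%C with ((E2 - s) * (E2 + s))%C by (rewrite <- Hss; ring).
rewrite Cmod_mult.
replace (16 * M / Cmod alpha) with (4 * M / Cmod alpha * 4) by (field; lra).
apply Rmult_le_compat; try assumption. apply Cmod_ge_0.
Qed.

Lemma Cmod_sqr (z : C) : Cmod z ^ 2 = Cmod (z * z).
Proof. rewrite Cmod_mult. ring. Qed.

Lemma robin_eigenvalue_near_dirichlet (a M eps : R) :
  0 < a -> 0 < eps ->
  exists R0, forall alpha lam, R0 < Cmod alpha -> Cmod lam <= M ->
  robin_eigenvalue a alpha lam ->
  exists k : Z, (0 < k)%Z /\ Cmod (lam - RtoC (PI ^ 2 * IZR k ^ 2 / (4 * a ^ 2))) < eps.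
Proof.
intros Ha Heps.
(* [N >= 1] makes [|theta|^2 <= N] imply [|theta| <= N], so one constant serves both kinds of
   bound. *)
set (N := Rmax M 0 + 1).
assert (HN : 1 <= N /\ M <= N).
{ unfold N. pose proof (Rmax_l M 0). pose proof (Rmax_r M 0). lra. }
(* [1 / (4 a)] is the range of [char_eq_unique]; the other terms make
   [|theta - kap| |theta + kap| < eps], the second factor being at most [2 N + 1]. *)
set (e := Rmin (1 / (4 * a)) (Rmin (eps / (2 * N + 2)) 1)).
assert (He : 0 < e).
{ repeat apply Rmin_glb_lt; try lra; apply Rdiv_lt_0_compat; lra. }
assert (He1 : e <= 1 / (4 * a)) by apply Rmin_l.
assert (He2 : e <= eps / (2 * N + 2)) by (eapply Rle_trans; [apply Rmin_r|apply Rmin_l]).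
assert (He3 : e <= 1) by (eapply Rle_trans; [apply Rmin_r|apply Rmin_r]).
assert (He1' : 4 * a * e <= 1).
{ apply (Rmult_le_compat_l (4 * a)) in He1; [|lra].
  replace (4 * a * (1 / (4 * a))) with 1 in He1 by (field; lra). exact He1. }
destruct (Cexp_near_1 (4 * a * e) ltac:(nra)) as [delta [Hdel Hnear]].
exists (Rmax (16 / a) (Rmax (2 * N) (16 * N / delta))).
intros alpha lam Hal Hlam Hrob.
assert (Hal1 : 16 / a < Cmod alpha) by (eapply Rle_lt_trans; [apply Rmax_l|exact Hal]).
assert (Hal' : Rmax (2 * N) (16 * N / delta) < Cmod alpha) by (eapply Rle_lt_trans; [apply Rmax_r|exact Hal]).
assert (Hal2 : 2 * N < Cmod alpha) by (eapply Rle_lt_trans; [apply Rmax_l|exact Hal']).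
assert (Hal3 : 16 * N / delta < Cmod alpha) by (eapply Rle_lt_trans; [apply Rmax_r|exact Hal']).
assert (Hal4 : 1 / a < Cmod alpha).
{ eapply Rle_lt_trans; [|exact Hal1]. apply Rmult_le_compat_r; [apply Rlt_le, Rinv_0_lt_compat|]; lra. }
assert (Hl0 : lam <> 0%C) by (intros ->; now apply (robin_eigenvalue_neq_0 a alpha Ha Hal4)).
destruct (Csqrt_exists (- lam)) as [theta Hth].
assert (Hth0 : theta <> 0%C).
{ intros ->. apply Hl0. replace lam with (- - lam)%C by ring. rewrite <- Hth. ring. }
destruct (robin_eigenvalue_char_eq a alpha lam theta Ha Hth0 Hth Hrob) as [s Hs].
assert (Hth2 : Cmod theta ^ 2 <= N).
{ rewrite Cmod_sqr, Hth, Cmod_opp. lra. }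
pose proof (Cmod_ge_0 theta) as Hthge.
assert (HthN : Cmod theta <= N) by nra.
pose proof (char_eq_Cexp_near_1 a N alpha theta s ltac:(lra) ltac:(lra) HthN Hs) as Hc.
assert (Hc' : 16 * N / Cmod alpha < delta).
{ apply Rmult_lt_reg_r with (Cmod alpha); [lra|].
  replace (16 * N / Cmod alpha * Cmod alpha) with (16 * N) by (field; lra).
  apply (Rmult_lt_compat_l delta) in Hal3; [|lra].
  replace (delta * (16 * N / delta)) with (16 * N) in Hal3 by (field; lra). lra. }
destruct (Hnear (4 * a * theta)%C ltac:(lra)) as [k Hk].
set (kap := (Ci * RtoC (PI * IZR k / (2 * a)))%C).
assert (Hkap : Cmod (theta - kap) < e).
{ replace (4 * a * theta - Ci * RtoC (2 * (IZR k * PI)))%C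
    with (RtoC (4 * a) * (theta - kap))%C in Hk.
  - rewrite Cmod_mult, Cmod_R, Rabs_right in Hk by lra. nra.
  - unfold kap.
    replace (2 * (IZR k * PI)) with (4 * a * (PI * IZR k / (2 * a))) by (field; lra).
    rewrite !RtoC_mult. ring. }
(* If [k = 0], then [theta] is so close to the spurious root 0 that uniqueness forces [theta = 0],
   hence [lam = 0]. *)
assert (Hk0 : k <> 0%Z).
{ intros ->. apply Hth0.
  assert (Hz : kap = 0%C).
  { unfold kap. replace (PI * 0 / (2 * a)) with 0 by (field; lra). ring. }
  apply (char_eq_unique a N alpha theta 0 s 1); try assumption.
  - nra.
  - rewrite Cmod_0. lra.
  - rewrite <- Hz. nra.
  - apply char_eq_0. }
exists (Z.abs k). split; [lia|].
assert (Hkk : (kap * kap = - RtoC (PI ^ 2 * IZR (Z.abs k) ^ 2 / (4 * a ^ 2)))%C).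
{ unfold kap. rewrite abs_IZR, pow2_abs.
  replace (PI ^ 2 * IZR k ^ 2 / (4 * a ^ 2)) with ((PI * IZR k / (2 * a)) * (PI * IZR k / (2 * a))) by (field; lra).
  rewrite RtoC_mult. set (r := RtoC (PI * IZR k / (2 * a))).
  apply Ceq_parts; unfold Re, Im; simpl; ring. }
replace (lam - RtoC (PI ^ 2 * IZR (Z.abs k) ^ 2 / (4 * a ^ 2)))%C
  with (- ((theta - kap) * (theta + kap)))%C.
2:{ transitivity (- (theta * theta) + kap * kap)%C; [ring|]. rewrite Hth, Hkk. ring. }
rewrite Cmod_opp, Cmod_mult.
assert (Hplus : Cmod (theta + kap) <= 2 * N + 1).
{ replace (theta + kap)%C with (2 * theta + - (theta - kap))%C by ring.
  eapply Rle_trans; [apply Cmod_triangle|].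
  rewrite Cmod_opp, Cmod_mult, Cmod_R, Rabs_right by lra. lra. }
assert (Hfin : e * (2 * N + 2) <= eps).
{ apply (Rmult_le_compat_r (2 * N + 2)) in He2; [|lra].
  replace (eps / (2 * N + 2) * (2 * N + 2)) with eps in He2 by (field; lra). exact He2. }
pose proof (Cmod_ge_0 (theta - kap)). pose proof (Cmod_ge_0 (theta + kap)). nra.
Qed.

(** If [mu1 = - t1^2] and [mu2 = - t2^2] are close, the product [(t1 - t2) (t1 + t2)] is small, so
    [t1] is close to [t2] or to [- t2]. Uniqueness of roots then gives [mu1 = mu2]. *)
Lemma no_crossing_at_infinity (a M : R) :
  0 < a ->
  exists R0, forall alpha mu, R0 < Cmod alpha -> Cmod mu <= M ->
  ~ eigenvalue_crossing a alpha mu.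
Proof.
intros Ha.
set (N := Rmax M 0 + 1).
assert (HN : 1 <= N /\ M + 1 <= N).
{ unfold N. pose proof (Rmax_l M 0). pose proof (Rmax_r M 0). lra. }
exists (16 / a + 2 * N + 1). intros alpha mu Hal Hmu Hcross.
assert (Hinv : 0 < 1 / a) by (apply Rdiv_lt_0_compat; lra).
assert (H16 : 16 / a = 16 * (1 / a)) by (field; lra).
(* The bound 1 keeps [beta] large and the eigenvalues below [N]. If both factors exceeded
   [1 / (4 a)], their product would exceed [1 / (16 a^2) >= 2 e]. *)
set (e := Rmin 1 (1 / (32 * a ^ 2))).
assert (He : 0 < e) by (apply Rmin_glb_lt; [lra|apply Rdiv_lt_0_compat; nra]).
assert (He1 : e <= 1) by apply Rmin_l.
assert (He2 : 16 * a ^ 2 * (2 * e) <= 1).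
{ assert (He2 : e <= 1 / (32 * a ^ 2)) by apply Rmin_r.
  apply (Rmult_le_compat_l (32 * a ^ 2)) in He2; [|nra].
  replace (32 * a ^ 2 * (1 / (32 * a ^ 2))) with 1 in He2 by (field; lra). lra. }
destruct (Hcross e He) as [beta [mu1 [mu2 [Hb [Hm1 [Hm2 [Hne [Hr1 Hr2]]]]]]]].
assert (Hbeta : 16 / a + 2 * N < Cmod beta).
{ pose proof (Cmod_minus_ge alpha (alpha - beta)) as H.
  replace (alpha - (alpha - beta))%C with beta in H by ring.
  replace (alpha - beta)%C with (- (beta - alpha))%C in H by ring.
  rewrite Cmod_opp in H. lra. }
assert (Hbd : forall nu, Cmod (nu - mu) < e -> Cmod nu <= N).
{ intros nu Hnu. pose proof (Cmod_triangle (nu - mu) mu) as H.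
  replace (nu - mu + mu)%C with nu in H by ring. lra. }
assert (Hroot : forall nu, Cmod (nu - mu) < e -> robin_eigenvalue a beta nu ->
  exists theta s, (theta * theta = - nu)%C /\ Cmod theta ^ 2 <= N /\ char_eq a beta theta s).
{ intros nu Hnu Hrob.
  assert (Hl0 : nu <> 0%C).
  { intros ->. revert Hrob. apply robin_eigenvalue_neq_0; lra. }
  destruct (Csqrt_exists (- nu)) as [theta Hth].
  assert (Hth0 : theta <> 0%C).
  { intros ->. apply Hl0. replace nu with (- - nu)%C by ring. rewrite <- Hth. ring. }
  destruct (robin_eigenvalue_char_eq a beta nu theta Ha Hth0 Hth Hrob) as [s Hs].
  exists theta, s. split; [exact Hth|]. split; [|exact Hs].
  rewrite Cmod_sqr, Hth, Cmod_opp. now apply Hbd. }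
destruct (Hroot mu1 Hm1 Hr1) as [t1 [s1 [Ht1 [Hb1 Hs1]]]].
destruct (Hroot mu2 Hm2 Hr2) as [t2 [s2 [Ht2 [Hb2 Hs2]]]].
assert (U : forall t, Cmod t ^ 2 <= N -> char_eq a beta t s2 ->
  4 * a * Cmod (t1 - t) <= 1 -> t1 = t).
{ intros t Ht Hs Hd. apply (char_eq_unique a N beta t1 t s1 s2); try assumption; nra. }
assert (Hprod : Cmod (t1 - t2) * Cmod (t1 + t2) < 2 * e).
{ rewrite <- Cmod_mult.
  replace ((t1 - t2) * (t1 + t2))%C with ((mu2 - mu) + - (mu1 - mu))%C.
  - eapply Rle_lt_trans; [apply Cmod_triangle|]. rewrite Cmod_opp. lra.
  - transitivity (t1 * t1 - t2 * t2)%C; [rewrite Ht1, Ht2|]; ring. }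
apply Hne.
assert (T : (t1 * t1 = t2 * t2)%C).
{ destruct (Rle_lt_dec (4 * a * Cmod (t1 - t2)) 1) as [H|H].
  - now rewrite <- (U t2 Hb2 Hs2 H).
  - destruct (Rle_lt_dec (4 * a * Cmod (t1 - - t2)) 1) as [H'|H'].
    + rewrite (U (- t2)%C); [ring| | |exact H'].
      * now rewrite Cmod_opp.
      * now apply char_eq_opp.
    + exfalso. replace (t1 - - t2)%C with (t1 + t2)%C in H' by ring.
      assert (1 < (4 * a * Cmod (t1 - t2)) * (4 * a * Cmod (t1 + t2))) by nra.
      assert (16 * a ^ 2 * (Cmod (t1 - t2) * Cmod (t1 + t2)) < 16 * a ^ 2 * (2 * e)).
      { apply Rmult_lt_compat_l; [nra|exact Hprod]. }
      nra. }
rewrite Ht1, Ht2 in T.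
replace mu1 with (- - mu1)%C by ring. rewrite T. ring.
Qed.

(** * Dirichlet eigenvalues and convergence of the eigencurve *)

Lemma dirichlet_eigenvalue_interval (a : R) (k : Z) :
  0 < a -> (0 < k)%Z ->
  dirichlet_eigenvalue a (RtoC (PI ^ 2 * IZR k ^ 2 / (4 * a ^ 2))).
Proof.
intros Ha Hk. apply IZR_lt in Hk.
set (kap := PI * IZR k / (2 * a)).
assert (Real : forall (f f' : R -> R) x, is_derive f x (f' x) ->
  @is_derive R_AbsRing C_R_NormedModule (fun t => RtoC (f t)) x (RtoC (f' x))).
{ intros f f' x H. apply is_derive_C_parts. split; [exact H|].
  exact (is_derive_const (V := R_NormedModule) 0 x). }
pose (f := fun t => sin (kap * (t + a))).
pose (f1 := fun t => kap * cos (kap * (t + a))).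
pose (f2 := fun t => - kap ^ 2 * sin (kap * (t + a))).
exists (fun t => RtoC (f t)), (fun t => RtoC (f1 t)), (fun t => RtoC (f2 t)).
split; [split; [|split]|split; [|split; [|split]]].
- intros x Hx. apply is_derive_is_derive_within; [exact Hx|].
  apply Real. unfold f, f1. auto_derive; [exact I|ring].
- intros x Hx. apply is_derive_is_derive_within; [exact Hx|].
  apply Real. unfold f1, f2. auto_derive; [exact I|ring].
- apply continuous_on_forall. intros x _. apply continuous_C_parts.
  split; [|exact (continuous_const 0 x)].
  apply (ex_derive_continuous (V := R_NormedModule)). unfold f2. simpl. auto_derive. exact I.
(* The first crest of the eigenfunction [sin (kap (x + a))]; it lies in the interval because
   [k >= 1]. *)
- exists (- a + a / IZR k). split.
  + unfold segment. assert (0 < a / IZR k) by (apply Rdiv_lt_0_compat; lra).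
    assert (a / IZR k <= a); [|lra].
    assert (1 <= IZR k) by (apply IZR_le; apply lt_IZR in Hk; lia).
    apply Rmult_le_reg_r with (IZR k); [lra|]. unfold Rdiv. rewrite Rmult_assoc, Rinv_l by lra. nra.
  + intros H. apply RtoC_inj in H. unfold f in H.
    replace (kap * (- a + a / IZR k + a)) with (PI / 2) in H by (unfold kap; field; lra).
    rewrite sin_PI2 in H. lra.
- intros x _. rewrite <- RtoC_opp, <- RtoC_mult. f_equal. unfold f, f2, kap. field. lra.
- apply (f_equal RtoC). unfold f. replace (kap * (- a + a)) with 0 by ring. apply sin_0.
- apply (f_equal RtoC). unfold f. apply sin_eq_0_1. exists k. unfold kap. field. lra.
Qed.

Lemma analytic_at_continuous (f : C -> C) (z : C) :
  analytic_at f z -> continuous f z.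
Proof.
intros H. apply locally_singleton in H.
apply ex_derive_continuous in H.
(* Differentiability uses modulus balls and [continuous] product balls; [locally_C] identifies their
   neighbourhoods. *)
intros P HP. apply (proj2 (locally_C z (fun w => P (f w)))). apply H; exact HP.
Qed.

(* The value [c * (n + 1 / 2)] is never taken, so by the intermediate value theorem
   the integer cannot change. *)
Lemma continuous_near_multiples_constant (c : R) (f : R -> R) :
  0 < c -> (forall t, continuous f t) ->
  (forall t, exists n : Z, Rabs (f t - c * IZR n) < c / 4) ->
  forall s t (n m : Z), Rabs (f s - c * IZR n) < c / 4 ->
  Rabs (f t - c * IZR m) < c / 4 -> n = m.
Proof.
intros Hc Hf Hnear s t n m Hn Hm.
assert (Lt : forall s t n m, Rabs (f s - c * IZR n) < c / 4 ->
  Rabs (f t - c * IZR m) < c / 4 -> ~ (n < m)%Z).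
{ clear s t n m Hn Hm. intros s t n m Hn Hm H.
  apply Rabs_def2 in Hn, Hm.
  assert (H1 : IZR n + 1 <= IZR m) by (rewrite <- plus_IZR; apply IZR_le; lia).
  destruct (IVT_gen_consistent f s t (c * (IZR n + 1 / 2)) Hf) as [r [_ Hr]].
  { unfold Rmin, Rmax. destruct (Rle_dec (f s) (f t)); nra. }
  destruct (Hnear r) as [q Hq]. rewrite Hr in Hq.
  replace (c * (IZR n + 1 / 2) - c * IZR q) with (c * (IZR n + 1 / 2 - IZR q)) in Hq by ring.
  apply Rabs_def2 in Hq.
  assert (q <= n \/ n + 1 <= q)%Z as [L|L] by lia; apply IZR_le in L;
    rewrite ?plus_IZR in L; nra. }
pose proof (Lt s t n m Hn Hm). pose proof (Lt t s m n Hm Hn). lia.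
Qed.

Theorem theorem2p1 (a : R) (ha : (0 < a)%R) (D : C -> Prop) (lam : C -> C)
    (hD : connected_at_infinity D)
    (hlam : analytic_eigencurve a D lam)
    (hbounded : bounded_at_infinity D lam) :
  exists j : Z,
    dirichlet_eigenvalue a (RtoC (PI ^ 2 * IZR j ^ 2 / (4 * a ^ 2))) /\
    filterlim lam (at_infinity D)
      (locally (RtoC (PI ^ 2 * IZR j ^ 2 / (4 * a ^ 2)))).
Proof.
destruct hD as [Hunb Hconn], hlam as [_ [Heig Han]], hbounded as [M [RM HM]].
(* The candidate limits are [c k^2], integer multiples of [c], so accuracy [c / 4] determines
   [k^2]. *)
set (c := PI ^ 2 / (4 * a ^ 2)).
assert (Hc : 0 < c) by (pose proof PI_RGT_0; apply Rdiv_lt_0_compat; nra).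
assert (Hck : forall k, PI ^ 2 * IZR k ^ 2 / (4 * a ^ 2) = c * IZR (k * k)).
{ intros k. rewrite mult_IZR. unfold c. field. lra. }
assert (Hre : forall z r, Cmod (z - RtoC r) < c / 4 -> Rabs (Re z - r) < c / 4).
{ intros z r H. eapply Rle_lt_trans; [|exact H].
  replace (Re z - r) with (Re (z - RtoC r)) by (unfold Re; simpl; ring). apply re_le_Cmod. }
destruct (robin_eigenvalue_near_dirichlet a M (c / 4) ha ltac:(lra)) as [R2 H2].
destruct (no_crossing_at_infinity a M ha) as [R3 H3].
(* Beyond [R0], on [D], [lam] is bounded by [M], localised, and free of crossings, hence
   continuous. *)
set (R0 := Rmax RM (Rmax R2 R3)).
assert (HR : forall r, R0 < r -> RM < r /\ R2 < r /\ R3 < r).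
{ intros r Hr. unfold R0 in Hr. pose proof (Rmax_l RM (Rmax R2 R3)).
  pose proof (Rmax_r RM (Rmax R2 R3)). pose proof (Rmax_l R2 R3). pose proof (Rmax_r R2 R3). lra. }
destruct (Hconn R0) as [R1 Hpath].
destruct (Hunb (Rmax R0 R1)) as [alpha0 [HD0 Hal0]].
assert (H00 : R0 < Cmod alpha0) by (eapply Rle_lt_trans; [apply Rmax_l|exact Hal0]).
assert (H01 : R1 < Cmod alpha0) by (eapply Rle_lt_trans; [apply Rmax_r|exact Hal0]).
assert (Hnear : forall alpha, D alpha -> R0 < Cmod alpha -> exists k : Z, (0 < k)%Z /\
  Cmod (lam alpha - RtoC (PI ^ 2 * IZR k ^ 2 / (4 * a ^ 2))) < c / 4).
{ intros alpha HD Hal. destruct (HR _ Hal) as [A1 [A2 A3]].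
  apply (H2 alpha); auto. }
destruct (Hnear alpha0 HD0 H00) as [j [Hj Hj0]].
(* A path beyond [R0] from the reference point [alpha0] carries the integer [j^2] to every far point
   of [D]. Squares are compared because [lam] does not see the sign of [k]. *)
assert (Hall : forall alpha k, D alpha -> R1 < Cmod alpha ->
  Cmod (lam alpha - RtoC (PI ^ 2 * IZR k ^ 2 / (4 * a ^ 2))) < c / 4 ->
  (j * j = k * k)%Z).
{ intros alpha k HD Hal Hk.
  destruct (Hpath alpha0 alpha HD0 H01 HD Hal) as [gamma [Gc [G0 [G1 GE]]]].
  pose (h := fun t => Re (lam (gamma (clamp 0 1 t)))).
  assert (Hin : forall t, segment 0 1 (clamp 0 1 t)) by (intros t; apply clamp_in; lra).
  apply (continuous_near_multiples_constant c h Hc) with (s := 0) (t := 1).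
  - intros t. destruct (GE _ (Hin t)) as [HDt HRt].
    destruct (HR _ HRt) as [A1 [A2 A3]].
    apply (continuous_C_parts (fun t => lam (gamma (clamp 0 1 t))) t).
    apply (continuous_comp (fun t => gamma (clamp 0 1 t)) lam).
    + apply continuous_clamp; [lra|exact Gc].
    + apply analytic_at_continuous, Han; [exact HDt|]. apply H3; auto.
  - intros t. destruct (GE _ (Hin t)) as [HDt HRt].
    destruct (Hnear _ HDt HRt) as [q [_ Hq]]. exists (q * q)%Z.
    rewrite <- Hck. now apply Hre.
  - unfold h. rewrite clamp_id by (unfold segment; lra). rewrite G0, <- Hck. now apply Hre.
  - unfold h. rewrite clamp_id by (unfold segment; lra). rewrite G1, <- Hck. now apply Hre. }
exists j. split; [now apply dirichlet_eigenvalue_interval|].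
intros P [eps Heps].
(* Localisation at accuracy [eps] produces some [k] depending on [alpha]; the cap [c / 4] lets
   [Hall] identify [k^2] with [j^2]. *)
set (e := Rmin eps (c / 4)).
destruct (robin_eigenvalue_near_dirichlet a M e ha) as [R4 H4].
{ apply Rmin_glb_lt; [apply cond_pos|lra]. }
exists (Rmax R0 (Rmax R1 R4)). intros alpha Hal HD.
assert (B0 : R0 < Cmod alpha) by (eapply Rle_lt_trans; [apply Rmax_l|exact Hal]).
assert (B' : Rmax R1 R4 < Cmod alpha) by (eapply Rle_lt_trans; [apply Rmax_r|exact Hal]).
assert (B1 : R1 < Cmod alpha) by (eapply Rle_lt_trans; [apply Rmax_l|exact B']).
assert (B4 : R4 < Cmod alpha) by (eapply Rle_lt_trans; [apply Rmax_r|exact B']).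
destruct (HR _ B0) as [A1 _].
destruct (H4 alpha (lam alpha) B4 (HM alpha A1 HD) (Heig alpha HD)) as [k [_ Hk]].
assert (Hjk : (j * j = k * k)%Z).
{ apply (Hall alpha); try assumption. eapply Rlt_le_trans; [exact Hk|apply Rmin_r]. }
apply Heps, C_NormedModule_mixin_compat1.
rewrite Hck, Hjk, <- Hck.
eapply Rlt_le_trans; [exact Hk|apply Rmin_l].
Qed.
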